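(* Let $T$ be a circular operator on a complex separable Hilbert space $\mathcal H$. Suppose that $k:=\dim\ker T^*<\infty$. Then there exists an orthonormal basis $\{e_j:j=1,\ldots,k\}$ of $\ker T^*$ such that for all $j=1,\ldots,k$, $\langle T^me_j,\,T^ne_j\rangle=0$ for all $m,n\in\mathbb N$ with $m\neq n$.
   Context: $\mathbb N$ denotes the set of non-negative integers and $\mathbb T=\{\lambda\in\mathbb C:|\lambda|=1\}$. A bounded linear operator $T$ on a complex Hilbert space $\mathcal H$ is circular if for each $\lambda\in\mathbb T$ there exists a unitary operator $U_\lambda$ on $\mathcal H$ such that $U_\lambda T=\lambda TU_\lambda$. *)

(* Defs.v *)
From HB Require Import structures.
From mathcomp Require Import all_boot all_order all_algebra.
From mathcomp Require Import complex ring lra.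
From mathcomp Require Import boolp classical_sets functions cardinality reals.
From mathcomp Require Import topology normedtype sequences.

Set Implicit Arguments.
Unset Strict Implicit.
Unset Printing Implicit Defensive.

Import Order.TTheory GRing.Theory Num.Theory.
Import numFieldNormedType.Exports.

Local Open Scope classical_set_scope.
Local Open Scope complex_scope.
Local Open Scope ring_scope.

(* Inner products are linear in the first variable and conjugate-linear in
   the second one, as in sesquilinear.v. *)
HB.mixin Record isHilbert (R : realType) (H : Type)
    of CompleteNormedModule R[i] H := {
  inner : {dot H for (@Num.conj R[i])};
  innerxx : forall x : H, inner x x = `|x| ^+ 2
}.

#[short(type="hilbertType")]
HB.structure Definition Hilbert (R : realType) :=
  {H of isHilbert R H & CompleteNormedModule R[i] H}.

Section operators.
Variables (R : realType) (H : hilbertType R).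
Implicit Types (T U : H -> H) (x y z : H) (V : set H).

Definition separable_space := exists2 D : set H, countable D & dense D.

Definition bounded_operator T :=
  exists M : R, forall x, `|T x| <= M%:C * `|x|.

Definition is_adjoint T (S : H -> H) :=
  forall x y, inner (T x) y = inner x (S y).

(* The value at operators without an adjoint is irrelevant: see adjointP. *)
Definition adjoint T : H -> H := xget (cst 0) [set S | is_adjoint T S].

Definition unitary_operator U :=
  [/\ bounded_operator U, cancel U (adjoint U) & cancel (adjoint U) U].

Definition circular (T : {linear H -> H}) :=
  bounded_operator T /\
  forall lambda : R[i], `|lambda| = 1 ->
    exists2 U : {linear H -> H}, unitary_operator U &
      forall x, U (T x) = lambda *: T (U x).

Definition ker T : set H := [set x | T x = 0].

Definition is_basis k (e : 'I_k -> H) V :=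
  (forall c : 'I_k -> R[i],
     \sum_(j < k) c j *: e j = 0 -> forall j, c j = 0) /\
  V = [set x | exists c : 'I_k -> R[i], x = \sum_(j < k) c j *: e j].

Definition has_dim V k := exists e : 'I_k -> H, is_basis e V.

Definition is_orthonormal k (e : 'I_k -> H) :=
  forall i j, inner (e i) (e j) = (i == j)%:R.

Definition orthonormal_basis k (e : 'I_k -> H) V :=
  is_basis e V /\ is_orthonormal e.

End operators.

Section adjoint_theory.
Variables (R : realType) (H : hilbertType R).
Implicit Types (T : {linear H -> H}) (x y z : H).

Local Notation Re := complex.Re.
Local Definition nr x : R := Re `|x|.
Local Definition rip x y : R := Re (inner x y).

Let nrE x : `|x| = (nr x)%:C.
Proof.
rewrite /nr; have := normr_ge0 x; case: `|x| => a b.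
by rewrite lecE /= => /andP[/eqP -> _].
Qed.

Let nr_ge0 x : 0 <= nr x.
Proof. by rewrite -ler0c -nrE. Qed.

Let ReD (a b : R[i]) : Re (a + b) = Re a + Re b.
Proof. by case: a b => [? ?] []. Qed.

Let ReZ (t : R) (a : R[i]) : Re (t%:C * a) = t * Re a.
Proof. by case: a => a b /=; rewrite mul0r subr0. Qed.

Let ripDl x y z : rip (x + y) z = rip x z + rip y z.
Proof. by rewrite /rip linearDl ReD. Qed.

Let ripZl t x z : rip (t%:C *: x) z = t * rip x z.
Proof. by rewrite /rip linearZl_LR ReZ. Qed.

Let ripC x y : rip x y = rip y x.
Proof. by rewrite /rip hermC /= expr0 mul1r; case: (inner y x). Qed.

Let ripDr x y z : rip z (x + y) = rip z x + rip z y.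
Proof. by rewrite ripC ripDl !(ripC z). Qed.

Let ripZr t x z : rip z (t%:C *: x) = t * rip z x.
Proof. by rewrite ripC ripZl (ripC z). Qed.

Let ripxx x : rip x x = nr x ^+ 2.
Proof. by rewrite /rip innerxx nrE -rmorphXn. Qed.

Let nr_ler x (e : R) : (nr x < e) = (`|x| < e%:C).
Proof. by rewrite nrE ltcR. Qed.

Let ripCS x y : `|rip x y| <= nr x * nr y.
Proof.
have [y0|y0] := eqVneq (nr y) 0.
  have -> : y = 0 by apply/eqP; rewrite -normr_eq0 nrE y0.
  by rewrite ripC -[0](scale0r 0) -[0 : R[i]]/(0%:C) ripZl mul0r normr0
             mulr_ge0.
have py : 0 < nr y by rewrite lt_neqAle eq_sym y0 nr_ge0.
rewrite -(@ler_pXn2r _ 2) ?nnegrE ?mulr_ge0// real_normK ?num_real//.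
have := sqr_ge0 (nr (x + (- rip x y / nr y ^+ 2)%:C *: y)).
rewrite -(ripxx (x + _)) !(ripDl, ripDr, ripZl, ripZr) (ripC y x) !ripxx => h.
have := mulr_ge0 (sqr_ge0 (nr y)) h; rewrite exprMn.
set p := rip x y; set q := nr y in y0 *; set s := nr x.
have -> : q ^+ 2 * (s ^+ 2 + - p / q ^+ 2 * p +
  (- p / q ^+ 2 * p + - p / q ^+ 2 * (- p / q ^+ 2 * q ^+ 2)))
  = s ^+ 2 * q ^+ 2 - p ^+ 2 by field.
by rewrite subr_ge0.
Qed.

Section riesz.
Variables (g : H -> R) (K : R).
Hypothesis gD : forall x y, g (x + y) = g x + g y.
Hypothesis gZ : forall t x, g (t%:C *: x) = t * g x.
Hypothesis gK : forall x, `|g x| <= K * nr x.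

Let J x := rip x x - 2 * g x.

Let J_lb x : - K ^+ 2 <= J x.
Proof.
rewrite /J ripxx.
have := gK x; rewrite ler_norml => /andP[_ h].
have := sqr_ge0 (nr x - K); nra.
Qed.

Let m := inf (range J).

Let J_inf : has_inf (range J).
Proof.
split; first by exists (J 0), 0.
by exists (- K ^+ 2) => _ [x _ <-].
Qed.

Let m_le x : m <= J x.
Proof. by apply: ge_inf; [case: J_inf|exists x]. Qed.

Let Jpar x y : nr (x - y) ^+ 2 = 2 * J x + 2 * J y - 4 * J (2^-1%:C *: (x + y)).
Proof.
rewrite /J gZ gD -ripxx -scaleN1r.
have -> : (-1 : R[i]) = (-1)%:C by rewrite rmorphN.
by rewrite !(ripDl, ripDr, ripZl, ripZr) (ripC y x); field.
Qed.

Let Jdist x y e : J x < m + e -> J y < m + e -> nr (x - y) ^+ 2 < 4 * e.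
Proof.
by move=> hx hy; rewrite Jpar; have := m_le (2^-1%:C *: (x + y)); lra.
Qed.

Let min_seq :
  exists u : nat -> H, forall n, J (u n) < m + n.+1%:R^-1.
Proof.
suff : forall n, exists x, J x < m + n.+1%:R^-1
  by move=> /choice[u uP]; exists u.
move=> n.
have e0 : 0 < n.+1%:R^-1 :> R by rewrite invr_gt0.
by have [_ [x _ <-]] := inf_adherent e0 J_inf; exists x.
Qed.

Let minimizer : exists z, forall e, 0 < e ->
  exists x, J x < m + e /\ nr (x - z) < e.
Proof.
have [u uJ] := min_seq.
have small e : 0 < e -> exists N, forall n, (N <= n)%N -> n.+1%:R^-1 < e :> R.
  move=> e0; exists (Num.truncn e^-1) => n Nn.
  rewrite invf_plt ?posrE//.
  apply: (lt_le_trans (truncnS_gt _)).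
  by rewrite ler_nat ltnS.
have cu : cvg (u @ \oo).
  apply/cauchy_cvgP/cauchy_ballP => e; rewrite ltcE /= => /andP[/eqP e1 e0].
  have eE : e = (Re e)%:C by case: e e1 {e0} => ? ? /= ->.
  have e40 : 0 < Re e ^+ 2 / 4 by rewrite divr_gt0 ?exprn_gt0.
  have [N hN] := small _ e40.
  have FN : (u @ \oo) (u @` [set n | (N <= n)%N]).
    by exists N => // n Nn /=; exists n.
  exists (u @` [set n | (N <= n)%N], u @` [set n | (N <= n)%N]) => //=.
  move=> [_ _] /= [[n Nn <-] [p Np <-]].
  rewrite -ball_normE /ball_ /= eE -nr_ler.
  rewrite -(@ltr_pXn2r _ 2) ?nnegrE ?(ltW e0)//.
  have -> : Re e ^+ 2 = 4 * (Re e ^+ 2 / 4) by field.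
  apply: Jdist.
    by apply: lt_trans (uJ n) _; rewrite ltrD2l hN.
  by apply: lt_trans (uJ p) _; rewrite ltrD2l hN.
exists (lim (u @ \oo)) => e e0.
have [N hN] := small _ e0.
have /cvgrPdist_lt /(_ e%:C) := cu.
rewrite ltcR => /(_ e0) [P _ hP].
exists (u (maxn N P)); split.
  by apply: lt_trans (uJ _) _; rewrite ltrD2l hN// leq_maxl.
by rewrite nr_ler distrC; apply: hP => /=; rewrite leq_maxr.
Qed.

Lemma riesz_real : exists z, forall x, g x = rip x z.
Proof.
have [z hz] := minimizer; exists z => h.
pose a := rip h z - g h.
have key t : 0 <= 2 * t * a + t ^+ 2 * nr h ^+ 2.
  apply/ler_addgt0Pl => d d0.
  pose e := d / (1 + 2 * `|t| * nr h).
  have D0 : 0 < 1 + 2 * `|t| * nr h by rewrite ltr_wpDr ?mulr_ge0.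
  have e0 : 0 < e by rewrite divr_gt0.
  have [x [Jx xz]] := hz e e0.
  have := m_le (x + t%:C *: h).
  have -> : J (x + t%:C *: h) =
      J x + 2 * t * (rip h x - g h) + t ^+ 2 * nr h ^+ 2.
    by rewrite /J gD gZ !(ripDl, ripDr, ripZl, ripZr) (ripC x h) -!ripxx; ring.
  have -> : rip h x - g h = a + rip h (x - z).
    rewrite /a -(scaleN1r z).
    have -> : (-1 : R[i]) = (-1)%:C by rewrite rmorphN.
    by rewrite ripDr ripZr; ring.
  have h1 : `|t * rip h (x - z)| <= `|t| * nr h * e.
    rewrite normrM -mulrA ler_wpM2l//.
    by apply: le_trans (ripCS _ _) _; rewrite ler_wpM2l// ltW.
  have h2 : t * rip h (x - z) <= `|t| * nr h * e := le_trans (ler_norm _) h1.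
  have dE : d = e + 2 * (`|t| * nr h * e).
    rewrite /e; field; by rewrite gt_eqF.
  rewrite dE; move: (rip h (x - z)) (`|t| * nr h * e) h2 Jx => r s.
  lra.
suff a0 : a = 0 by apply/esym/eqP; rewrite -subr_eq0 -/a a0.
have [n0|n0] := eqVneq (nr h) 0.
  by have := key 1; have := key (-1); rewrite n0; lra.
have := key (- a / nr h ^+ 2).
have -> : 2 * (- a / nr h ^+ 2) * a + (- a / nr h ^+ 2) ^+ 2 * nr h ^+ 2
   = - (a / nr h) ^+ 2 by field.
rewrite oppr_ge0 => h1; have : (a / nr h) ^+ 2 == 0.
  by rewrite eq_le h1 sqr_ge0.
by rewrite sqrf_eq0 mulf_eq0 invr_eq0 (negPf n0) orbF => /eqP.
Qed.

End riesz.

Lemma bounded_operator_continuous T : bounded_operator T <-> continuous T.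
Proof.
split=> [[M hM]|].
  apply: bounded_linear_continuous; apply/linear_boundedP.
  near=> r => x; apply: le_trans (hM x) _; rewrite ler_wpM2r//.
  by near: r; apply: nbhs_pinfty_ge; rewrite realE !ler0c lecR; exact: le_total.
move=> /(_ 0)/continuous_linear_bounded/linear_boundedP[M [Mr hM]].
have Mlt : M < M + 1 by rewrite ltrDl.
have := hM _ Mlt; rewrite -(RRe_real Mr) -[1]/(1%:C) -rmorphD => h.
by exists (Re M + 1).
Unshelve. all: by end_near. Qed.

Lemma adjoint_exists T : bounded_operator T -> exists S, is_adjoint T S.
Proof.
move=> [M hM].
suff : forall y, exists z, forall x, inner (T x) y = inner x z.
  by move=> /choice[S hS]; exists S => x y; exact: hS.
move=> y.
have [||x|z hz] := @riesz_real (fun x => rip (T x) y) (M * nr y).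
- by move=> x x'; rewrite linearD ripDl.
- by move=> t x; rewrite linearZ ripZl.
- apply: le_trans (ripCS _ _) _; rewrite mulrAC ler_wpM2r//.
  by have := hM x; rewrite !nrE -rmorphM lecR.
exists z => x.
have hr := hz x; have := hz ('i *: x); rewrite /rip in hr *.
rewrite linearZ !linearZl_LR !(mulrC 'i) !ReiNIm => /oppr_inj hi.
by apply/eqP; rewrite eq_complex; apply/andP; split; apply/eqP.
Qed.

Lemma adjointP T : bounded_operator T -> is_adjoint T (adjoint T).
Proof. by move=> /adjoint_exists[S hS]; exact: (@xgetI _ _ _ S). Qed.

End adjoint_theory.

(* Main.v *)
(** Fix [lambda] of modulus 1 which is not a root of unity.  The unitary
    [U] with [U T = lambda T U] maps [ker T*] into itself, hence it has an
    orthonormal basis of eigenvectors there.  If [U e = mu e] then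
    [<T^m e, T^n e> = <U T^m e, U T^n e> = lambda^(m-n) <T^m e, T^n e>], so
    that this vanishes for [m <> n].  A single [lambda] is enough, and no
    regularity of [lambda |-> U_lambda] is involved. *)
Require Import Defs.
From HB Require Import structures.
From mathcomp Require Import all_boot all_order all_algebra.
From mathcomp Require Import complex ring zify.
From mathcomp Require Import spectral sesquilinear.
From mathcomp Require Import boolp classical_sets functions cardinality reals.
From mathcomp Require Import topology normedtype.

Set Implicit Arguments.
Unset Strict Implicit.
Unset Printing Implicit Defensive.

Import Order.TTheory GRing.Theory Num.Theory.
Import numFieldNormedType.Exports.

Local Open Scope classical_set_scope.
Local Open Scope complex_scope.
Local Open Scope ring_scope.

Local Notation "M ^t*" := (M ^t Num.conj)%sesqui (at level 30).

(** * A point of the unit circle that is not a root of unity *)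

Section lambda0.
Variable R : realType.

(** The Pythagorean triple 3, 4, 5 gives modulus 1, and [5 * lambda0] is a Gaussian integer, whose
    powers can be followed modulo 5. *)
Definition lambda0 : R[i] := (3 / 5) +i* (4 / 5).

Lemma norm_lambda0 : `|lambda0| = 1.
Proof.
apply/eqP; rewrite -(@pexpr_eq1 _ _ 2)// normCK -[_^*]/(conjc _) /lambda0 /=.
by rewrite eq_complex /=; apply/andP; split; apply/eqP; field.
Qed.

(* [(3 + 4 i)^2 = -7 + 24 i] is congruent to [3 + 4 i] modulo 5. *)
Lemma expr_lambda0 n : exists a b : int,
  (5 * lambda0) ^+ n.+1 = (3 + 5 * a)%:~R +i* (4 + 5 * b)%:~R.
Proof.
have E : 5 * lambda0 = 3 +i* 4.
  have -> : 5 = 5%:C :> R[i] by rewrite rmorph_nat.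
  by rewrite /lambda0; apply/eqP; rewrite eq_complex /=; apply/andP; split;
    apply/eqP; field.
rewrite E; elim: n => [|n [a [b IH]]].
  by exists 0, 0; rewrite expr1.
exists (-2 + 3 * a - 4 * b), (4 + 3 * b + 4 * a).
rewrite exprS IH; apply/eqP; rewrite eq_complex /=.
by rewrite !(rmorphD, rmorphN, rmorphM, rmorphB) /=; apply/andP; split;
  apply/eqP; ring.
Qed.

(** Otherwise [(5 * lambda0) ^+ n] would equal [5 ^+ n], which is real, while its imaginary part is
    congruent to 4 modulo 5. *)
Lemma expr_lambda0_neq1 n : (0 < n)%N -> lambda0 ^+ n != 1.
Proof.
case: n => // n _; apply/eqP => L1.
have [a [b]] := expr_lambda0 n.
rewrite exprMn L1 mulr1 => /(congr1 (@complex.Im R)) /=.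
have -> : 5 = 5%:C :> R[i] by rewrite rmorph_nat.
rewrite -rmorphXn /= => /esym/eqP; rewrite intr_eq0 => /eqP; lia.
Qed.

Lemma expr_lambda0_inj : injective (GRing.exp lambda0).
Proof.
have L0 : lambda0 != 0 by rewrite -normr_eq0 norm_lambda0 oner_eq0.
have lt m n : (m < n)%N -> lambda0 ^+ m <> lambda0 ^+ n.
  move=> mn E; have /expr_lambda0_neq1/eqP : (0 < n - m)%N by rewrite subn_gt0.
  by apply; rewrite expfB// -E divff// expf_neq0.
by move=> m n E; case: (ltngtP m n) => // /lt[]; rewrite E.
Qed.

End lambda0.

(** * Gram matrices and orthonormal eigenbases in finite dimension *)

Section gram.
Variables (R : realType) (H : hilbertType R).
Implicit Types (x y : H) (V : set H).

(** The family [f] is seen as a column on which matrices act from the left, each row holding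
    coordinates. Changes of basis then become matrix products, within reach of the spectral theorem
    for normal matrices. *)
Definition lincomb l k (f : 'I_k -> H) (A : 'M[R[i]]_(l, k)) (i : 'I_l) : H :=
  \sum_j A i j *: f j.

Definition gram k (f : 'I_k -> H) : 'M[R[i]]_k := \matrix_(i, j) inner (f i) (f j).

Lemma innerC x y : inner x y = (inner y x)^*.
Proof. by rewrite hermC expr0 mul1r. Qed.

Lemma inner_eq0 x : (inner x x == 0) = (x == 0).
Proof. by rewrite innerxx sqrf_eq0 normr_eq0. Qed.

Lemma innerZl a x y : inner (a *: x) y = a * inner x y.
Proof. exact: linearZl_LR. Qed.

Lemma innerZr a x y : inner x (a *: y) = a^* * inner x y.
Proof. by rewrite innerC innerZl rmorphM /= -innerC. Qed.

Lemma inner_suml I r (P : pred I) (f : I -> H) y :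
  inner (\sum_(i <- r | P i) f i) y = \sum_(i <- r | P i) inner (f i) y.
Proof. exact: linear_sumlz. Qed.

Lemma inner_sumr I r (P : pred I) (f : I -> H) x :
  inner x (\sum_(i <- r | P i) f i) = \sum_(i <- r | P i) inner x (f i).
Proof. exact: linear_sumr. Qed.

Lemma lincombM k l p (f : 'I_k -> H) (A : 'M_(p, l)) (B : 'M_(l, k)) :
  lincomb f (A *m B) = lincomb (lincomb f B) A.
Proof.
apply/funext => i; rewrite /lincomb.
under eq_bigr do rewrite mxE scaler_suml.
rewrite exchange_big /=; apply: eq_bigr => j _.
by rewrite scaler_sumr; apply: eq_bigr => q _; rewrite scalerA.
Qed.

Lemma lincomb1 k (f : 'I_k -> H) : lincomb f 1%:M = f.
Proof.
apply/funext => i; rewrite /lincomb (bigD1 i)//= big1 ?addr0.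
  by rewrite mxE eqxx scale1r.
by move=> j /negPf ji; rewrite mxE eq_sym ji scale0r.
Qed.

Lemma lincomb_diag k (f : 'I_k -> H) (d : 'rV_k) i :
  lincomb f (diag_mx d) i = d 0 i *: f i.
Proof.
rewrite /lincomb (bigD1 i)//= big1 ?addr0.
  by rewrite mxE eqxx.
by move=> j /negPf ji; rewrite mxE eq_sym ji scale0r.
Qed.

Lemma lincomb_row k (f : 'I_k -> H) (c : 'I_k -> R[i]) i :
  lincomb f (\row_j c j) i = \sum_j c j *: f j.
Proof. by apply: eq_bigr => j _; rewrite mxE. Qed.

Lemma gram_lincomb k l (f : 'I_k -> H) (A : 'M_(l, k)) :
  gram (lincomb f A) = A *m gram f *m A ^t*.
Proof.
apply/matrixP => i j; rewrite !mxE inner_sumr.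
apply: eq_bigr => q _; rewrite innerZr mulrC !mxE; congr (_ * _).
by rewrite inner_suml; apply: eq_bigr => p _; rewrite innerZl !mxE.
Qed.

Lemma gram_hermitian k (f : 'I_k -> H) : (gram f) ^t* = gram f.
Proof. by apply/matrixP => i j; rewrite !mxE -innerC. Qed.

Lemma is_orthonormalP k (f : 'I_k -> H) : is_orthonormal f <-> gram f = 1%:M.
Proof.
split=> [fP|/matrixP fP i j]; last by have := fP i j; rewrite !mxE.
by apply/matrixP => i j; rewrite !mxE.
Qed.

Lemma is_basis_lincomb k (f : 'I_k -> H) (A : 'M_k) V :
  A \in unitmx -> is_basis f V -> is_basis (lincomb f A) V.
Proof.
move=> uA [f_free ->]; split=> [c c0 j|].
  suff : \row_j c j *m A = 0.
    by move/(canRL (mulmxK uA))/rowP/(_ j); rewrite mul0mx !mxE.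
  apply/rowP => q; rewrite [RHS]mxE; apply: f_free.
  by rewrite -(lincomb_row _ _ 0) -lincombM in c0.
apply/seteqP; split=> x [c ->] /=.
  exists ((\row_j c j *m invmx A) 0).
  by rewrite -(lincomb_row _ _ 0) -[X in lincomb f X](mulmxKV uA) lincombM.
exists ((\row_j c j *m A) 0).
by rewrite -(lincomb_row _ _ 0) -lincombM.
Qed.

Lemma is_basis_mem k (f : 'I_k -> H) V j : is_basis f V -> V (f j).
Proof.
by move=> [_ ->]; exists ((1%:M : 'M_k) j); rewrite -[LHS](congr1 (@^~ j) (lincomb1 f)).
Qed.

Lemma is_basis_neq0 k (f : 'I_k -> H) V j : is_basis f V -> f j != 0.
Proof.
move=> [f_free _]; apply/eqP => fj0.
have := f_free ((1%:M : 'M_k) j) _ j; rewrite !mxE eqxx => f1.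
suff /f1/eqP : \sum_i (1%:M : 'M[R[i]]_k) j i *: f i = 0 by rewrite oner_eq0.
by rewrite -/(lincomb f 1%:M j) lincomb1.
Qed.

(* Diagonalizing the Gram matrix replaces the Gram-Schmidt process. *)
Lemma has_dim_orthonormal_basis V k : has_dim V k ->
  exists e : 'I_k -> H, orthonormal_basis e V.
Proof.
move=> [f0 f0V].
have /orthomx_spectralP GE : gram f0 \is normalmx.
  by apply/normalmxP; rewrite gram_hermitian.
set P := spectralmx _ in GE; set D := spectral_diag _ in GE.
have uP : P \in unitmx := spectral_unit _.
pose f := lincomb f0 P.
have fV : is_basis f V by exact: is_basis_lincomb.
(* Since [P] is unitary, the congruence by [P] is also a similarity, so it diagonalizes the Gram
   matrix: [f] is orthogonal and only has to be normalized. *)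
have fG : gram f = diag_mx D.
  rewrite gram_lincomb {1}GE -invmx_unitary ?spectral_unitarymx//.
  by rewrite !mulmxA mulmxV// mul1mx mulmxK.
have fi0 i : `|f i|^-1 != 0 by rewrite invr_eq0 normr_eq0 (is_basis_neq0 _ fV).
pose N := diag_mx (\row_i `|f i|^-1).
exists (lincomb f N); split.
  apply: is_basis_lincomb fV.
  by rewrite unitmxE det_diag unitfE; apply/prodf_neq0 => i _; rewrite mxE.
move=> i j; rewrite !lincomb_diag !mxE innerZl innerZr.
have /matrixP/(_ i j) := fG; rewrite !mxE => ->.
have [<-{j}|_] := eqVneq i j; last by rewrite !mulr0n !mulr0.
have /matrixP/(_ i i) := fG; rewrite !mxE eqxx innerxx => <-.
rewrite conj_Creal ?realV ?normr_real// mulrA -expr2 -exprMn.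
by rewrite mulVf ?expr1n// -invr_eq0.
Qed.

(** In an orthonormal basis of [V] the matrix of [U] is unitary, hence normal, hence diagonalized by
    a unitary change of basis, which keeps the basis orthonormal. *)
Lemma isometry_orthonormal_eigenbasis (U : {linear H -> H}) V k :
  (forall x y, inner (U x) (U y) = inner x y) ->
  (forall x, V x -> V (U x)) -> has_dim V k ->
  exists e : 'I_k -> H, orthonormal_basis e V /\
    exists mu : 'I_k -> R[i], forall j, U (e j) = mu j *: e j.
Proof.
move=> Uiso UV /has_dim_orthonormal_basis[f [fV fO]].
have /is_orthonormalP f1 := fO.
have [A UA] : exists A : 'M[R[i]]_k, U \o f = lincomb f A.
  have /choice[a aP] : forall i, exists c : 'I_k -> R[i],
      U (f i) = \sum_j c j *: f j.
    by move=> i; have := UV _ (is_basis_mem i fV); case: fV => _ ->.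
  exists (\matrix_(i, j) a i j); apply/funext => i; rewrite /= aP.
  by apply: eq_bigr => j _; rewrite mxE.
(* Both sides are the Gram matrix of [U \o f]. *)
have AA : A *m A ^t* = 1%:M.
  have := gram_lincomb f A; rewrite f1 mulmx1 -UA => <-.
  by apply/is_orthonormalP => p q; rewrite /= Uiso fO.
have /orthomx_spectralP AE : A \is normalmx.
  by apply/normalmxP; rewrite AA (mulmx1C AA).
set P := spectralmx _ in AE; set D := spectral_diag _ in AE.
have uP : P \in unitmx := spectral_unit _.
exists (lincomb f P); split.
  split; first exact: is_basis_lincomb.
  apply/is_orthonormalP; rewrite gram_lincomb f1 mulmx1.
  exact/unitarymxP/spectral_unitarymx.
exists (D 0) => j.
rewrite -lincomb_diag -lincombM.
(* The rows of [P] are left eigenvectors of [A], that is, coordinates of eigenvectors of [U]. *)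
have -> : diag_mx D *m P = P *m A by rewrite AE !mulmxA mulmxV// mul1mx.
rewrite lincombM -UA linear_sum; apply: eq_bigr => i _.
by rewrite linearZ.
Qed.

End gram.

(** * Unitaries intertwining [T] with a multiple of itself *)

Section circular.
Variables (R : realType) (H : hilbertType R).
Implicit Types (T U : {linear H -> H}) (x y : H).

Lemma unitary_inner U : unitary_operator U ->
  forall x y, inner (U x) (U y) = inner x y.
Proof. by move=> [bU UK _] x y; rewrite (adjointP bU) UK. Qed.

(** For every [v], [<T U v, U x> = l^-1 <U T v, U x> = l^-1 <T v, x> = l^-1 <v, T* x> = 0]. As [U]
    is onto, [U v] can be taken equal to [T* U x], whose norm is therefore zero. *)
Lemma unitary_ker_adjoint T U (l : R[i]) :
  bounded_operator T -> unitary_operator U -> l != 0 ->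
  (forall x, U (T x) = l *: T (U x)) ->
  forall x, ker (adjoint T) x -> ker (adjoint T) (U x).
Proof.
move=> bT uU l0 UT x kx; rewrite /ker /=; apply/eqP; rewrite -inner_eq0.
set w := adjoint T (U x); have [_ _ KU] := uU.
rewrite -(adjointP bT) -(KU w) -[T _](scalerK l0) -UT innerZl.
by rewrite (unitary_inner uU) (adjointP bT) kx linear0r mulr0.
Qed.

Lemma iter_intertwine T U (l mu : R[i]) x n :
  (forall x, U (T x) = l *: T (U x)) -> U x = mu *: x ->
  U (iter n T x) = (l ^+ n * mu) *: iter n T x.
Proof.
move=> UT Ux; elim: n => [|n IH]; first by rewrite expr0 mul1r.
by rewrite iterS UT IH linearZ scalerA mulrA -exprS.
Qed.

Lemma inner_iter_eq0 T U (l mu : R[i]) x m n :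
  (forall x y, inner (U x) (U y) = inner x y) ->
  (forall x, U (T x) = l *: T (U x)) -> U x = mu *: x ->
  `|l| = 1 -> l ^+ m != l ^+ n -> inner (iter m T x) (iter n T x) = 0.
Proof.
move=> Uiso UT Ux l1 lmn; apply/eqP; rewrite -[_ == 0]negbK; apply/negP => nz.
(* A nonzero [x] is what allows [|mu| = 1] to be read off from [<U x, U x> = <x, x>]. *)
have x0 : x != 0.
  apply: contra_neq nz => ->; have -> : iter m T 0 = 0.
    by elim: m {lmn} => //= m ->; rewrite linear0.
  by rewrite linear0l.
have mu1 : mu * mu^* = 1.
  apply: (mulIf (x := inner x x)); first by rewrite inner_eq0.
  by rewrite mul1r -[RHS]Uiso Ux innerZl innerZr mulrA.
move: lmn; apply/negP; rewrite negbK.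
(* As [|l| = 1], the equality [l ^+ m = l ^+ n] amounts to [l ^+ m * (l ^+ n)^* = 1]. The left side
   is the factor by which applying [U] to both arguments multiplies the inner product, assumed
   nonzero. *)
apply/eqP; apply: (mulIf (x := (l ^+ n)^*)).
  by rewrite conjC_eq0 expf_eq0 -normr_eq0 l1 oner_eq0 andbF.
rewrite -[RHS]normCK normrX l1 !expr1n.
apply: (mulIf nz); rewrite mul1r -[RHS]Uiso.
rewrite !(iter_intertwine _ UT Ux) innerZl innerZr rmorphM /= mulrA.
by rewrite [_ * mu * _]mulrACA mu1 mulr1.
Qed.


End circular.

Theorem proposition2p3 (R : realType) (H : hilbertType R)
    (hH : separable_space H) (T : {linear H -> H}) (hT : circular T)
    (k : nat) (hk : has_dim (ker (adjoint T)) k) :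
  exists e : 'I_k -> H,
    orthonormal_basis e (ker (adjoint T)) /\
    forall (j : 'I_k) (m n : nat), m <> n ->
      inner (iter m T (e j)) (iter n T (e j)) = 0.
Proof.
have [bT /(_ _ (norm_lambda0 R))[U uU UT]] := hT.
have Uiso := unitary_inner uU.
have l0 : lambda0 R != 0 by rewrite -normr_eq0 norm_lambda0 oner_eq0.
have [e [eV [mu Ue]]] := isometry_orthonormal_eigenbasis Uiso
  (unitary_ker_adjoint bT uU l0 UT) hk.
exists e; split=> // j m n /eqP mn.
apply: (inner_iter_eq0 Uiso UT (Ue j) (norm_lambda0 R)).
by rewrite (inj_eq (@expr_lambda0_inj R)).
Qed.
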